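(* Let $N\ge 1$ be an integer, let $m$ be Lebesgue measure on $\mathbf{R}^N$, and let $X=\{X_t;\ t\in\mathbf{R}^N_+\}$ be a real-valued stochastic process with $E[X_t^2]<\infty$ for all $t$. Assume that 1. $X$ is self-similar of index $\alpha$ for some $\alpha\in(0,N/2)$; 2. $X$ is $\mathcal{C}_0$-increment stationary with respect to the Lebesgue measure $m$. Then there is a constant $K$ (not depending on $s,t$) such that for all $s,t\in\mathbf{R}^N_+$ with $s\prec t$, $$E[X_sX_t]=K\left[m([0,s])^{2\alpha/N}+m([0,t])^{2\alpha/N}-m([0,t]\setminus[0,s])^{2\alpha/N}\right].$$
   Context: $\mathbf{R}^N_+=[0,\infty)^N$. For $s,t\in\mathbf{R}^N_+$, $s\prec t$ (equivalently $t\succ s$) means $s_i\le t_i$ for all $i=1,\dots,N$, and $[0,t]=\prod_{i=1}^N[0,t_i]$. $\stackrel{(d)}{=}$ denotes equality of finite-dimensional distributions for processes and equality in law for random variables. Self-similarity of index $\alpha$: for all $a\in\mathbf{R}_+$, $\{X_{at};\ t\in\mathbf{R}^N_+\}\stackrel{(d)}{=}\{a^{\alpha}X_t;\ t\in\mathbf{R}^N_+\}$. $\mathcal{C}_0$-increment stationarity (also called measure stationarity) with respect to $m$: for all $t\in\mathbf{R}^N_+$ and all $\tau,\tau'\in\mathbf{R}^N_+$ with $\tau\succ\tau'$, if $m([0,\tau])-m([0,\tau'])=m([0,t])$ then $X_t-X_0\stackrel{(d)}{=}X_\tau-X_{\tau'}$. *)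

(* Defs.v *)
From HB Require Import structures.
From mathcomp Require Import all_boot all_order all_algebra.
From mathcomp Require Import all_classical all_reals all_analysis.

Set Implicit Arguments.
Unset Strict Implicit.
Unset Printing Implicit Defensive.

Import Order.TTheory GRing.Theory Num.Theory.
Import numFieldNormedType.Exports.

Local Open Scope classical_set_scope.
Local Open Scope ring_scope.

Section lebesgue_measure_step.
Context {R : realType} (n : nat).
Variable mu : {sigma_finite_measure set (n.-tuple R) -> \bar R}.

Definition tuple_of_prod (p : R * n.-tuple R) : n.+1.-tuple R :=
  [tuple of p.1 :: p.2].

Lemma measurable_tuple_of_prod : measurable_fun [set: _] tuple_of_prod.
Proof. exact: measurable_cons. Qed.

Definition lebesgue_measure_step : set (n.+1.-tuple R) -> \bar R :=
  pushforward (@lebesgue_measure R \x mu)%E tuple_of_prod.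

Let step0 : lebesgue_measure_step set0 = 0%E.
Proof. by rewrite /lebesgue_measure_step /pushforward preimage_set0 measure0. Qed.

Let step_ge0 A : (0 <= lebesgue_measure_step A)%E.
Proof. by rewrite /lebesgue_measure_step /pushforward measure_ge0. Qed.

Let step_sigma_additive : semi_sigma_additive lebesgue_measure_step.
Proof.
rewrite /lebesgue_measure_step; apply: measure_semi_sigma_additive.
exact: measurable_tuple_of_prod.
Qed.

HB.instance Definition _ := isMeasure.Build _ _ _ lebesgue_measure_step
  step0 step_ge0 step_sigma_additive.

Let step_sigma_finite : sigma_finite setT lebesgue_measure_step.
Proof.
have [F TF Foo] : sigma_finite setT (@lebesgue_measure R \x mu)%E.
  have /sigma_finiteP[F [TF ndF Foo]] := sigma_finiteT (@lebesgue_measure R).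
  have /sigma_finiteP[G [TG ndG Goo]] := sigma_finiteT mu.
  exists (fun i => F i `*` G i).
    apply/esym; rewrite -subTset => -[x u] _.
    have [i _ Fix] : (\bigcup_i F i) x by rewrite -TF.
    have [j _ Gju] : (\bigcup_j G j) u by rewrite -TG.
    exists (maxn i j) => //; split => /=.
      by move: x Fix; exact/subsetPset/ndF/leq_maxl.
    by move: u Gju; exact/subsetPset/ndG/leq_maxr.
  move=> i; have [? ?] := Foo i; have [? ?] := Goo i.
  split; first exact: measurableX.
  by rewrite product_measure1E// lte_mul_pinfty// ge0_fin_numE.
pose uncons (x : n.+1.-tuple R) : R * n.-tuple R := (thead x, [tuple of behead x]).
have munc : measurable_fun [set: n.+1.-tuple R] uncons.
  apply/measurable_fun_pairP; split; first exact: measurable_tnth.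
  exact: measurable_behead.
have unK : cancel tuple_of_prod uncons.
  by move=> [x u]; rewrite /uncons theadE; congr pair; apply/val_inj.
exists (fun i => uncons @^-1` F i).
  by rewrite -preimage_bigcup -TF preimage_setT.
move=> i; have [mF Fi] := Foo i; split.
  by rewrite -[X in measurable X]setTI; exact: munc.
rewrite /lebesgue_measure_step /pushforward -comp_preimage.
by rewrite (_ : uncons \o tuple_of_prod = id)//; apply/funext => p /=; rewrite unK.
Qed.

HB.instance Definition _ := Measure_isSigmaFinite.Build _ _ _
  lebesgue_measure_step step_sigma_finite.

End lebesgue_measure_step.

(* Lebesgue measure on R^n, seen as n.-tuple R with its product
   sigma-algebra: the n-fold product of the one-dimensional measure. *)
Fixpoint lebesgue_measure_n (R : realType) (n : nat) :
    {sigma_finite_measure set (n.-tuple R) -> \bar R} :=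
  match n return {sigma_finite_measure set (n.-tuple R) -> \bar R} with
  | 0 => \d_([tuple] : 0.-tuple R)
  | n'.+1 => lebesgue_measure_step (lebesgue_measure_n R n')
  end.

Section points.
Context {R : realType} {N : nat}.
Implicit Types s t : N.-tuple R.

Definition orthant : set (N.-tuple R) := [set t | forall i, 0 <= tnth t i].

Definition origin : N.-tuple R := [tuple 0 | i < N].

Definition scale_tuple (a : R) t : N.-tuple R := [tuple a * tnth t i | i < N].

Definition tuple_le s t := forall i, tnth s i <= tnth t i.

Definition box t : set (N.-tuple R) :=
  [set x | forall i, 0 <= tnth x i <= tnth t i].

End points.

Lemma measurable_box (R : realType) n (t : n.-tuple R) : measurable (box t).
Proof.
rewrite (_ : box t = \bigcap_(i in [set: 'I_n])
    (@tnth n R ^~ i @^-1` `[0, tnth t i]%classic)).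
  apply: fin_bigcap_measurable => [|i _]; first exact: finite_finset.
  by rewrite -[X in measurable X]setTI; exact: measurable_tnth.
apply/seteqP; split=> x /= h i; first by move=> _; have := h i; rewrite /= in_itv.
by have := h i I; rewrite /= in_itv.
Qed.

Lemma lebesgue_measure_box (R : realType) n (t : n.-tuple R) : orthant t ->
  lebesgue_measure_n R n (box t) = (\prod_(i < n) tnth t i)%:E.
Proof.
elim: n t => [|n IH] t ot.
  rewrite big_ord0 /= diracE mem_set//= => -[]//.
rewrite /= /lebesgue_measure_step /pushforward.
rewrite (_ : _ @^-1` _ = `[0, thead t]%classic `*` box [tuple of behead t]); last first.
  apply/seteqP; split => -[x u] /=.
    move=> h; split => /=.
      by have := h ord0; rewrite in_itv/= /tuple_of_prod/= tnth0.
    move=> i; have := h (lift ord0 i); rewrite /tuple_of_prod tnthS/=.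
    by rewrite [in X in X -> _](tuple_eta t) tnthS.
  move=> [/= h1 h2] i; case: (unliftP ord0 i) => [j|] ->.
    by rewrite /tuple_of_prod tnthS [t in X in _ <= _ <= X]tuple_eta tnthS; exact: h2.
  by move: h1; rewrite in_itv/= tnth0.
rewrite product_measure1E//; last first.
  exact: measurable_box.
rewrite IH; last by move=> i; have := ot (lift ord0 i); rewrite [in X in X -> _](tuple_eta t) tnthS.
rewrite big_ord_recl EFinM; congr (_ * _)%E; last first.
  by congr EFin; apply: eq_bigr => i _; rewrite [in RHS](tuple_eta t) tnthS.
rewrite [LHS](lebesgue_measure_itv `[0, thead t]) /= lte_fin.
have := ot ord0; rewrite -/(thead t) le_eqVlt => /orP[/eqP <-|->].
  by rewrite ltxx.
by rewrite oppr0 adde0.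
Qed.

Section processes.
Context d (T : measurableType d) (R : realType) (P : probability T R).

Definition eq_in_law d' (E : measurableType d') (Y Z : T -> E) :=
  forall A : set E, measurable A -> pushforward P Y A = pushforward P Z A.

Definition eq_fdd (I : Type) (D : set I) (Y Z : I -> T -> R) :=
  forall (n : nat) (u : 'I_n -> I), (forall k, D (u k)) ->
  eq_in_law (fun w => [tuple Y (u k) w | k < n])
            (fun w => [tuple Z (u k) w | k < n]).

Context (N : nat).

(* A process indexed by the orthant is given by a family X indexed by the
   whole of R^N, of which only the values on the orthant are ever used. *)
Implicit Types X : N.-tuple R -> {RV P >-> R}.

(* a = 0 is allowed, with 0 `^ alpha = 0 for alpha != 0. *)
Definition self_similar (alpha : R) X :=
  forall a : R, 0 <= a ->
  eq_fdd orthant (fun t => X (scale_tuple a t))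
                 (fun t w => a `^ alpha * X t w).

Definition C0_increment_stationary (m : set (N.-tuple R) -> \bar R) X :=
  forall t tau tau' : N.-tuple R,
  orthant t -> orthant tau -> orthant tau' -> tuple_le tau' tau ->
  (m (box tau) - m (box tau') = m (box t))%E ->
  eq_in_law (fun w => X t w - X origin w) (fun w => X tau w - X tau' w).

End processes.

(* Main.v *)
(* Self-similarity at a = 0 makes X_0 vanish almost surely. Measure stationarity
   then gives X_t - X_s the law of X_u, where u = (c, ..., c) and c^N is the
   volume of [0, t] minus that of [0, s], and self-similarity gives
   E[X_u^2] = c^(2 alpha) E[X_(1, ..., 1)^2]. The covariance follows by
   polarization, with K = E[X_(1, ..., 1)^2] / 2. *)
Require Import Defs.
From mathcomp Require Import all_boot all_order all_algebra.
From mathcomp Require Import all_classical all_reals all_analysis.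
From mathcomp Require Import measurable_realfun ring.

Set Implicit Arguments.
Unset Strict Implicit.
Unset Printing Implicit Defensive.

Import Order.TTheory GRing.Theory Num.Theory.
Import numFieldNormedType.Exports.

Local Open Scope classical_set_scope.
Local Open Scope ring_scope.

Section second_moment.
Context d (T : measurableType d) (R : realType) (P : probability T R).
Implicit Types Y Z : T -> R.

Lemma measurable_sqr_EFin Y : measurable_fun setT Y ->
  measurable_fun setT (EFin \o (fun w => Y w ^+ 2)).
Proof. by move=> mY; apply/measurable_EFinP; exact: measurable_funX. Qed.

(** By change of variables each side is the integral of the square of [x] against an image law, and
    the two laws agree on measurable sets. *)
Lemma eq_in_law_expectation_sqr Y Z :
    measurable_fun setT Y -> measurable_fun setT Z -> eq_in_law P Y Z ->
  'E_P[fun w => (Y w ^+ 2)%R]%E = 'E_P[fun w => (Z w ^+ 2)%R]%E.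
Proof.
move=> mY mZ YZ; rewrite unlock.
have push (W : T -> R) : measurable_fun setT W ->
    (\int[P]_w (W w ^+ 2)%:E = \int[pushforward P W]_x ((x : R) ^+ 2)%R%:E)%E.
  move=> mW; rewrite ge0_integral_pushforward//.
  - by apply/measurable_EFinP; apply: measurable_funX.
  - by move=> x _; rewrite lee_fin sqr_ge0.
rewrite (push _ mY) (push _ mZ).
by apply: eq_measure_integral => A mA _; exact: YZ.
Qed.

Lemma ae_eq_expectation_sqr Y Z :
    measurable_fun setT Y -> measurable_fun setT Z ->
    (\forall w \ae P, Y w = Z w) ->
  'E_P[fun w => (Y w ^+ 2)%R]%E = 'E_P[fun w => (Z w ^+ 2)%R]%E.
Proof.
move=> mY mZ YZ; rewrite unlock; apply: ge0_ae_eq_integral => //.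
- exact: measurable_sqr_EFin.
- exact: measurable_sqr_EFin.
- by move=> w _; rewrite lee_fin sqr_ge0.
- by move=> w _; rewrite lee_fin sqr_ge0.
- by apply: filterS YZ => w /= -> _.
Qed.

Lemma expectation_sqr_eq0 Y : measurable_fun setT Y ->
  'E_P[fun w => (Y w ^+ 2)%R]%E = 0%E -> \forall w \ae P, Y w = 0.
Proof.
move=> mY; rewrite unlock => Y0.
have : (\int[P]_w `|(Y w ^+ 2)%R%:E| = 0)%E.
  by rewrite -Y0; apply: eq_integral => w _; rewrite gee0_abs// lee_fin sqr_ge0.
move=> /(ae_eq_integral_abs P measurableT (measurable_sqr_EFin mY)).
by apply: filterS => w /= /(_ I) [] /eqP; rewrite sqrf_eq0 => /eqP.
Qed.

Lemma integrable_sqr Y a : measurable_fun setT Y ->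
  'E_P[fun w => (Y w ^+ 2)%R]%E = a%:E ->
  P.-integrable setT (EFin \o (fun w => Y w ^+ 2)).
Proof.
move=> mY; rewrite unlock => Ya; apply/integrableP.
split; first exact: measurable_sqr_EFin.
under eq_integral do rewrite gee0_abs ?lee_fin ?sqr_ge0//.
by rewrite Ya ltry.
Qed.

(* Polarization makes YZ a combination of squares, so that no Hoelder
   inequality is needed for its integrability. *)
Lemma expectation_mul_polarization Y Z a b c :
    measurable_fun setT Y -> measurable_fun setT Z ->
    'E_P[fun w => (Y w ^+ 2)%R]%E = a%:E -> 'E_P[fun w => (Z w ^+ 2)%R]%E = b%:E ->
    'E_P[fun w => ((Z w - Y w) ^+ 2)%R]%E = c%:E ->
  'E_P[fun w => (Y w * Z w)%R]%E = (2^-1 * (a + b - c))%:E.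
Proof.
move=> mY mZ Ya Zb ZYc.
have iY := integrable_sqr mY Ya.
have iZ := integrable_sqr mZ Zb.
have iZY := integrable_sqr (measurable_funB mZ mY) ZYc.
move: Ya Zb ZYc; rewrite unlock => Ya Zb ZYc.
transitivity (\int[P]_w ((2^-1)%:E *
    ((Y w ^+ 2)%R%:E + (Z w ^+ 2)%R%:E - ((Z w - Y w) ^+ 2)%R%:E)))%E.
  by apply: eq_integral => w _; congr EFin; field.
rewrite integralZl//; last by apply: integrableB => //; exact: integrableD.
rewrite integralB//; last exact: integrableD.
by rewrite integralD// Ya Zb ZYc.
Qed.

End second_moment.

(** Take a single index: a measurable [A] lifts to the set [B] of 1-tuples whose entry lies in
    [A]. *)
Lemma eq_fdd_law d (T : measurableType d) (R : realType) (P : probability T R)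
    (I : Type) (D : set I) (Y Z : I -> T -> R) (i : I) :
  eq_fdd P D Y Z -> D i -> eq_in_law P (Y i) (Z i).
Proof.
move=> YZ Di A mA.
pose B : set (1.-tuple R) := [set x | A (tnth x ord0)].
have mB : measurable B.
  by rewrite -[B]setTI; exact: measurable_tnth.
have := YZ 1%N (fun=> i) (fun=> Di) B mB.
have pushB (W : I -> T -> R) :
    pushforward P (fun w => [tuple W i w | _ < 1]) B = pushforward P (W i) A.
  by congr (P _); apply/funext => w; rewrite /B /preimage/= tnth_mktuple.
by rewrite (pushB Y) (pushB Z).
Qed.

Section cubes.
Context {R : realType} (N : nat).

(** Corners of cubes with side [c]: for [N > 0] they realize every volume, and scaling permutes
    them, so self-similarity reduces them all to [cube 1]. *)
Definition cube (c : R) : N.-tuple R := [tuple c | i < N].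

Lemma orthant_cube c : 0 <= c -> orthant (cube c).
Proof. by move=> c0 i; rewrite tnth_mktuple. Qed.

Lemma scale_cube a c : scale_tuple a (cube c) = cube (a * c).
Proof. by apply: eq_from_tnth => i; rewrite !tnth_mktuple. Qed.

Lemma prod_cube c : \prod_(i < N) tnth (cube c) i = c ^+ N.
Proof.
by under eq_bigr do rewrite tnth_mktuple; rewrite prodr_const card_ord.
Qed.

Lemma lebesgue_measure_boxD (s t : N.-tuple R) :
    orthant s -> orthant t -> tuple_le s t ->
  lebesgue_measure_n R N (box t `\` box s) =
  (\prod_(i < N) tnth t i - \prod_(i < N) tnth s i)%:E.
Proof.
move=> os ot st.
(* Finiteness is what allows volumes to be subtracted in the extended reals. *)
have toy : (lebesgue_measure_n R N (box t) < +oo)%E.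
  by rewrite lebesgue_measure_box// ltry.
transitivity
  (lebesgue_measure_n R N (box t) - lebesgue_measure_n R N (box s))%E; last first.
  by rewrite !lebesgue_measure_box.
have bst : box t `&` box s = box s.
  apply: setIidr => x xs i; have /andP[-> xi] := xs i.
  by rewrite (le_trans xi).
rewrite -{2}bst.
exact: (measureD (measurable_box t) (measurable_box s) toy).
Qed.

End cubes.

Section self_similar_stationary.
Context d (T : measurableType d) (R : realType) (P : probability T R).
Context (N : nat) (X : N.-tuple R -> {RV P >-> R}) (alpha : R).
Hypothesis N_gt0 : (0 < N)%N.
Hypothesis X2 :
  forall t, orthant t -> ('E_P[fun w => (X t w ^+ 2)%R] < +oo)%E.
Hypothesis alpha_neq0 : alpha != 0.
Hypothesis Xss : self_similar alpha X.
Hypothesis Xstat : C0_increment_stationary (lebesgue_measure_n R N) X.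

(** Twice the constant [K] of the theorem; [X2] ensures that [fine] loses nothing. *)
Let second_moment1 : R := fine 'E_P[fun w => (X (cube N 1) w ^+ 2)%R]%E.

Lemma expectation_sqr_cube c : 0 <= c ->
  'E_P[fun w => (X (cube N c) w ^+ 2)%R]%E =
  ((c `^ alpha) ^+ 2 * second_moment1)%:E.
Proof.
move=> c0.
have o1 : orthant (cube N (1 : R)) by exact: orthant_cube.
have mX t : measurable_fun setT (X t) by [].
have mcX : measurable_fun setT (fun w => c `^ alpha * X (cube N 1) w).
  exact: measurable_funM.
have law : eq_in_law P (X (cube N c)) (fun w => c `^ alpha * X (cube N 1) w).
  (* Writing [c] as [c * 1] exhibits the cube as a scaled unit cube. *)
  by rewrite -[c in X (cube N c)]mulr1 -scale_cube; exact: eq_fdd_law (Xss c0) o1.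
rewrite (eq_in_law_expectation_sqr (mX _) mcX law) unlock.
transitivity (\int[P]_w
    (((c `^ alpha) ^+ 2)%:E * (X (cube N 1) w ^+ 2)%R%:E))%E.
  by apply: eq_integral => w _; rewrite exprMn EFinM.
rewrite ge0_integralZl_EFin ?sqr_ge0//; last 2 first.
  by move=> w _; rewrite lee_fin sqr_ge0.
  exact: measurable_sqr_EFin.
rewrite [in RHS]EFinM /second_moment1 fineK.
  by rewrite unlock.
rewrite ge0_fin_numE; first exact: X2.
by apply: expectation_ge0 => w; exact: sqr_ge0.
Qed.

Lemma origin_ae0 : \forall w \ae P, X origin w = 0.
Proof.
apply: expectation_sqr_eq0 => //.
by rewrite (expectation_sqr_cube (lexx 0)) powR0// expr0n mul0r.
Qed.

Lemma expectation_sqr_increment s t :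
    orthant s -> orthant t -> tuple_le s t ->
  'E_P[fun w => ((X t w - X s w) ^+ 2)%R]%E =
  ((\prod_(i < N) tnth t i - \prod_(i < N) tnth s i) `^ (2 * alpha / N%:R)
   * second_moment1)%:E.
Proof.
move=> os ot st.
set v := \prod_(i < N) _ - _.
have v0 : 0 <= v.
  rewrite subr_ge0; apply: ler_prod => i _.
  by rewrite os st.
(* The side of the cube whose volume is [v], so that stationarity compares the increment with
   [X (cube N c)]. *)
pose c := v `^ N%:R^-1.
have c0 : 0 <= c by exact: powR_ge0.
have cN : c ^+ N = v.
  by rewrite -powR_mulrn// -powRrM mulVf ?pnatr_eq0 -?lt0n// powRr1.
have law : eq_in_law P (fun w => X (cube N c) w - X origin w)
                       (fun w => X t w - X s w).
  apply: Xstat => //; first exact: orthant_cube.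
  rewrite !lebesgue_measure_box//; last exact: orthant_cube.
  by rewrite prod_cube cN.
rewrite -(eq_in_law_expectation_sqr _ _ law); [|exact: measurable_funB..].
(* The term [X origin] vanishes almost surely and drops out. *)
rewrite (@ae_eq_expectation_sqr _ _ _ _ _ (X (cube N c))) //; last 2 first.
- exact: measurable_funB.
- by apply: filterS origin_ae0 => w /= ->; rewrite subr0.
rewrite expectation_sqr_cube// -powR_mulrn ?powR_ge0// -!powRrM.
by congr (_ `^ _ * _)%:E; ring.
Qed.

(** This is the increment from the origin, where [X] vanishes almost surely. *)
Lemma expectation_sqr_orthant t : orthant t ->
  'E_P[fun w => (X t w ^+ 2)%R]%E =
  ((\prod_(i < N) tnth t i) `^ (2 * alpha / N%:R) * second_moment1)%:E.
Proof.
move=> ot; have o0 : orthant (@origin R N) by exact: (@orthant_cube _ N 0).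
have := expectation_sqr_increment o0 ot.
(* The box at the origin has volume [0 ^+ N], which is 0 only for positive [N], since [0 ^+ 0] is
   1. *)
rewrite [X in _ - X](prod_cube N 0) expr0n eqn0Ngt N_gt0 subr0 => <-; last first.
  by move=> i; rewrite tnth_mktuple.
apply: ae_eq_expectation_sqr => //; first exact: measurable_funB.
by apply: filterS origin_ae0 => w /= ->; rewrite subr0.
Qed.

(** Polarization applied to the second moments of [X s], [X t] and their difference. *)
Lemma covariance_self_similar_stationary s t :
    orthant s -> orthant t -> tuple_le s t ->
  'E_P[fun w => (X s w * X t w)%R]%E =
  (second_moment1 / 2 *
    ((\prod_(i < N) tnth s i) `^ (2 * alpha / N%:R)
     + (\prod_(i < N) tnth t i) `^ (2 * alpha / N%:R)
     - (\prod_(i < N) tnth t i - \prod_(i < N) tnth s i)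
         `^ (2 * alpha / N%:R)))%:E.
Proof.
move=> os ot st.
rewrite (expectation_mul_polarization _ _ (expectation_sqr_orthant os)
  (expectation_sqr_orthant ot) (expectation_sqr_increment os ot st))//.
by congr EFin; ring.
Qed.

End self_similar_stationary.

Theorem proposition4 (d : measure_display) (T : measurableType d)
    (R : realType) (P : probability T R) (N : nat) (hN : (1 <= N)%N)
    (X : N.-tuple R -> {RV P >-> R})
    (hX2 : forall t, orthant t -> ('E_P[fun w => (X t w ^+ 2)%R] < +oo)%E)
    (alpha : R) (halpha : 0 < alpha < N%:R / 2)
    (hss : self_similar alpha X)
    (hstat : C0_increment_stationary (lebesgue_measure_n R N) X) :
  exists K : R, forall s t : N.-tuple R,
    orthant s -> orthant t -> tuple_le s t ->
    ('E_P[fun w => (X s w * X t w)%R])%E =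
    (K * (fine (lebesgue_measure_n R N (box s)) `^ (2 * alpha / N%:R)
          + fine (lebesgue_measure_n R N (box t)) `^ (2 * alpha / N%:R)
          - fine (lebesgue_measure_n R N (box t `\` box s)) `^ (2 * alpha / N%:R)))%:E.
Proof.
have /andP[alpha0 _] := halpha.
exists (fine 'E_P[fun w => (X (cube N 1) w ^+ 2)%R]%E / 2) => s t os ot st.
rewrite lebesgue_measure_boxD// !lebesgue_measure_box//.
by apply: covariance_self_similar_stationary => //; rewrite gt_eqF.
Qed.
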